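(* If $X_1,X_2,\dots,X_m\in\mathbb{M}_n$ ($m\ge1$) are accretive-dissipative, then $$\omega(X_1\circ\cdots\circ X_m)\le2^{m/2}\prod_{j=1}^m\omega(X_j).$$
   Context: $\mathbb{M}_n$ is the algebra of all $n\times n$ complex matrices. For $X=[x_{ij}],Y=[y_{ij}]\in\mathbb{M}_n$ the Hadamard product is $X\circ Y=[x_{ij}y_{ij}]$. For $X\in\mathbb{M}_n$, write $\operatorname{Re}X=\frac{X+X^*}{2}$ and $\operatorname{Im}X=\frac{X-X^*}{2i}$ (both Hermitian). $X$ is accretive-dissipative if both $\operatorname{Re}X$ and $\operatorname{Im}X$ are positive definite. The numerical radius is $\omega(X)=\sup\{|\langle Xx,x\rangle| : x\in\mathbb{C}^n,\ \|x\|=1\}$, with the standard inner product and Euclidean norm on $\mathbb{C}^n$. *)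

(* Defs.v *)
From mathcomp Require Import all_boot all_order all_algebra.
From mathcomp Require Import complex.
From mathcomp Require Import classical_sets reals exp.
Set Implicit Arguments.
Unset Strict Implicit.
Unset Printing Implicit Defensive.
Import Order.TTheory GRing.Theory Num.Theory.
Local Open Scope ring_scope.
Local Open Scope sesquilinear_scope.
Local Open Scope classical_set_scope.

Definition hadamard (K : pzRingType) (m n : nat) (A B : 'M[K]_(m, n)) :
  'M[K]_(m, n) := map2_mx *%R A B.

Section ComplexMatrices.
Variable C : numClosedFieldType.

(* [dotmx] is the Hermitian product of row vectors, antilinear on the right. *)
Definition cdot (n : nat) (x y : 'cV[C]_n) : C := dotmx x^T y^T.

Definition enorm (n : nat) (x : 'cV[C]_n) : C := sqrtC (cdot x x).

Definition re_mx (n : nat) (A : 'M[C]_n) : 'M[C]_n := 2^-1 *: (A + A ^t*).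

Definition im_mx (n : nat) (A : 'M[C]_n) : 'M[C]_n :=
  (2 * 'i)^-1 *: (A - A ^t*).

(* In the partial order of [C], [0 < z] means that [z] is real and positive. *)
Definition posdef_mx (n : nat) (A : 'M[C]_n) : Prop :=
  A \is hermsymmx /\ forall x : 'cV[C]_n, x != 0 -> 0 < cdot (A *m x) x.

Definition accretive_dissipative (n : nat) (A : 'M[C]_n) : Prop :=
  posdef_mx (re_mx A) /\ posdef_mx (im_mx A).

End ComplexMatrices.

(* [Normc.normc] is the modulus with values in [R]: [`|z| = (normc z)%:C].
   The set is nonempty and bounded for [0 < n]; for [n = 0] it is empty and
   [sup set0 = 0]. *)
Definition numerical_radius (R : realType) (n : nat) (A : 'M[R[i]]_n) : R :=
  sup [set Normc.normc (cdot (A *m x) x) | x in [set x | enorm x = 1]].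

(* Main.v *)
(** Write [X_j = A_j + i B_j] with [A_j], [B_j] positive definite and put
    [S_j = A_j + B_j].  Expanding the Hadamard product over the [A_j] and [B_j]
    and using that Hadamard products of positive semidefinite matrices are
    positive semidefinite (Schur), the form of [X_1 o ... o X_m] is dominated in
    modulus by the form of [S_1 o ... o S_m].  Since [a + b <= sqrt 2 |a + i b|],
    one has [S_j <= sqrt 2 w(X_j) I]; Schur's theorem again then bounds
    [S_1 o ... o S_m] by [2^(m/2) w(X_1) ... w(X_m) I]. *)
Require Import Defs.
From mathcomp Require Import all_boot all_order all_algebra.
From mathcomp Require Import complex ring.
From mathcomp Require Import classical_sets reals exp.
Set Implicit Arguments.
Unset Strict Implicit.
Unset Printing Implicit Defensive.
Import Order.TTheory GRing.Theory Num.Theory.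
Local Open Scope ring_scope.
Local Open Scope sesquilinear_scope.

Section PositiveSemidefinite.
Variable C : numClosedFieldType.
Implicit Type n : nat.

(** * Quadratic forms of complex matrices *)

Definition qform n (A : 'M[C]_n) (x : 'cV[C]_n) : C := cdot (A *m x) x.

Definition psdmx n (A : 'M[C]_n) : Prop :=
  A \is hermsymmx /\ forall x, 0 <= qform A x.

Lemma cdotE n (x y : 'cV[C]_n) : cdot x y = \sum_i x i 0 * (y i 0)^*.
Proof. by rewrite /cdot dotmxE mxE; apply: eq_bigr => i _; rewrite !mxE. Qed.

Lemma qformE n (A : 'M[C]_n) x :
  qform A x = \sum_i \sum_j A i j * x j 0 * (x i 0)^*.
Proof.
by rewrite /qform cdotE; apply: eq_bigr => i _; rewrite mxE big_distrl.
Qed.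

Lemma qformD n (A B : 'M[C]_n) x : qform (A + B) x = qform A x + qform B x.
Proof.
by rewrite /qform !cdotE -big_split; apply: eq_bigr => i _;
  rewrite mulmxDl mxE mulrDl.
Qed.

Lemma qformZ n a (A : 'M[C]_n) x : qform (a *: A) x = a * qform A x.
Proof.
by rewrite /qform !cdotE big_distrr; apply: eq_bigr => i _;
  rewrite /= -scalemxAl mxE mulrA.
Qed.

Lemma qform_scalar n a (x : 'cV[C]_n) : qform a%:M x = a * cdot x x.
Proof. by rewrite -[a%:M]scalemx1 qformZ /qform mul1mx. Qed.

Lemma qform_scale n (A : 'M[C]_n) a x :
  qform A (a *: x) = `|a| ^+ 2 * qform A x.
Proof.
rewrite /qform !cdotE big_distrr; apply: eq_bigr => i _ /=.
by rewrite -scalemxAr !mxE rmorphM normCK mulrACA.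
Qed.

Lemma qform0 n (A : 'M[C]_n) : qform A 0 = 0.
Proof. by rewrite -(scale0r 0) qform_scale normr0 expr0n mul0r. Qed.

Lemma qform_delta n (A : 'M[C]_n) i : qform A (delta_mx i 0) = A i i.
Proof.
rewrite /qform -colE cdotE (bigD1 i) //= big1 ?addr0 => [|j ji].
  by rewrite !mxE !eqxx rmorph1 mulr1.
by rewrite !mxE (negPf ji) rmorph0 mulr0.
Qed.

Lemma cdotxx n (x : 'cV[C]_n) : cdot x x = \sum_i `|x i 0| ^+ 2.
Proof. by rewrite cdotE; apply: eq_bigr => i _; rewrite normCK. Qed.

(** * Positive semidefinite matrices and Schur's product theorem *)

Lemma hermsymE n (A : 'M[C]_n) :
  A \is hermsymmx <-> forall i j, A i j = (A j i)^*.
Proof.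
split=> [/is_hermitianmxP AE i j|AE].
  by rewrite {1}AE expr0 scale1r !mxE.
by apply/is_hermitianmxP; rewrite expr0 scale1r; apply/matrixP => i j;
  rewrite !mxE AE.
Qed.

Lemma psdmxD n (A B : 'M[C]_n) : psdmx A -> psdmx B -> psdmx (A + B).
Proof.
move=> [/hermsymE hA pA] [/hermsymE hB pB]; split; last first.
  by move=> x; rewrite qformD addr_ge0.
by apply/hermsymE => i j; rewrite !mxE hA hB rmorphD.
Qed.

Lemma posdef_psdmx n (A : 'M[C]_n) : posdef_mx A -> psdmx A.
Proof.
move=> [hA pA]; split=> // x; have [->|x0] := eqVneq x 0.
  by rewrite qform0.
exact: ltW (pA x x0).
Qed.

Lemma qform_mxE n (A : 'M[C]_n) x : qform A x = (x^t* *m A *m x) 0 0.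
Proof.
rewrite /qform cdotE -mulmxA mxE; apply: eq_bigr => i _.
by rewrite [_^t* _ _]mxE [x^T _ _]mxE mulrC.
Qed.

(** By the spectral theorem [A] is [P^* D P] with [P] unitary and [D] diagonal and nonnegative, so
    [G] can be taken to be [sqrt D P]. *)
Lemma psdmx_gram n (A : 'M[C]_n) :
  psdmx A -> exists G : 'M[C]_n, forall i j, A i j = \sum_k (G k i)^* * G k j.
Proof.
move=> [hA pA]; have uP := spectral_unitarymx A.
have /orthomx_spectralP := hermitian_normalmx hA.
set P := spectralmx A in uP *; set d := spectral_diag A => AE.
rewrite invmx_unitary // in AE.
have d_ge0 k : 0 <= d 0 k.
  have -> : d 0 k = (P *m A *m P^t*) k k.
    rewrite AE !mulmxA (unitarymxP uP) mul1mx -mulmxA (unitarymxP uP) mulmx1.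
    by rewrite mxE eqxx.
  (* The adjoint of row [k] of [P] is a unit eigenvector for [d 0 k], so this eigenvalue is a value
     of the form of [A]. *)
  suff -> : (P *m A *m P^t*) k k = qform A ((row k P)^t*) by [].
  rewrite qform_mxE trmxCK -row_mul !mxE; apply: eq_bigr => i _.
  by rewrite !mxE.
exists (\matrix_(k, i) (sqrtC (d 0 k) * P k i)) => i j.
rewrite {1}AE mul_mx_diag mxE; apply: eq_bigr => k _.
have sR : (sqrtC (d 0 k))^* = sqrtC (d 0 k).
  by apply/CrealP; rewrite ger0_real ?sqrtC_ge0.
by rewrite !mxE rmorphM /= sR -{1}[d 0 k]sqrtCK; ring.
Qed.

(** Schur's product theorem. A Gram factor [G] of [A] splits the form of the product at [x] into a
    sum of values of the form of [B], one for each row of [G] multiplied entrywise by [x]. *)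
Lemma hadamard_psd n (A B : 'M[C]_n) :
  psdmx A -> psdmx B -> psdmx (hadamard A B).
Proof.
move=> pA [/hermsymE hB pB]; split.
  case: pA => /hermsymE hA _.
  by apply/hermsymE => i j; rewrite !mxE hA hB rmorphM.
move=> x; have [G AE] := psdmx_gram pA.
have -> : qform (hadamard A B) x = \sum_k qform B (\col_i (G k i * x i 0)).
  under [RHS]eq_bigr do rewrite qformE.
  rewrite qformE [RHS]exchange_big; apply: eq_bigr => i _ /=.
  rewrite [RHS]exchange_big; apply: eq_bigr => j _ /=.
  rewrite !mxE AE !big_distrl; apply: eq_bigr => k _ /=.
  by rewrite !mxE rmorphM /=; ring.
by apply: sumr_ge0.
Qed.

(** * Iterated Hadamard products, whose neutral element is the all-ones matrix *)

Lemma const1_psd n : psdmx (const_mx 1 : 'M[C]_n).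
Proof.
split=> [|x]; first by apply/hermsymE => i j; rewrite !mxE rmorph1.
suff -> : qform (const_mx 1) x = `|\sum_i x i 0| ^+ 2 by rewrite exprn_ge0.
rewrite qformE normCK rmorph_sum big_distrlr exchange_big.
by apply: eq_bigr => i _; apply: eq_bigr => j _; rewrite mxE mul1r.
Qed.

Lemma big_hadamard_psd n (I : Type) (r : seq I) (S : I -> 'M[C]_n) :
  (forall i, psdmx (S i)) ->
  psdmx (\big[@hadamard C n n/const_mx 1]_(i <- r) S i).
Proof.
by move=> pS; apply: big_ind => //;
  [exact: const1_psd | move=> A B; exact: hadamard_psd].
Qed.

(** By Schur, the form of [S o T] is at most that of [c I o T], which is diagonal with entries
    [c * T i i]. Only the diagonal of [T] has to be bounded. *)
Lemma qform_hadamard_le n (S T : 'M[C]_n) c t x :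
    psdmx (c%:M - S) -> psdmx T -> 0 <= c -> (forall i, T i i <= t) ->
  qform (hadamard S T) x <= c * t * cdot x x.
Proof.
move=> pS pT c0 Tt; have [_ /(_ x)] := hadamard_psd pS pT.
have -> : hadamard (c%:M - S) T = hadamard c%:M T + -1 *: hadamard S T.
  by apply/matrixP => i j; rewrite !mxE; ring.
rewrite qformD qformZ mulN1r subr_ge0 => /le_trans; apply.
rewrite cdotxx big_distrr qformE; apply: ler_sum => i _ /=.
rewrite (bigD1 i) //= big1 ?addr0 => [|j ji].
  rewrite !mxE eqxx mulr1n -[_ * _^*]mulrA -normCK.
  by rewrite ler_wpM2r ?exprn_ge0 // ler_wpM2l.
by rewrite !mxE eq_sym (negPf ji) !mul0r.
Qed.

(** The first factor is compared with a scalar matrix; the others enter only through their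
    diagonals, which multiply and satisfy [0 <= S j i i <= c j]. At least one factor is required:
    the form of the all-ones matrix can exceed [cdot x x]. *)
Lemma qform_big_hadamard_le n m (S : 'I_m.+1 -> 'M[C]_n) (c : 'I_m.+1 -> C) x :
    (forall j, psdmx (S j)) -> (forall j, psdmx ((c j)%:M - S j)) ->
    (forall j, 0 <= c j) ->
  qform (\big[@hadamard C n n/const_mx 1]_(j < m.+1) S j) x <=
    (\prod_(j < m.+1) c j) * cdot x x.
Proof.
move=> pS pcS c0; rewrite !big_ord_recl.
apply: qform_hadamard_le => // [|i]; first exact: big_hadamard_psd.
have -> : (\big[@hadamard C n n/const_mx 1]_(j < m) S (lift ord0 j)) i i =
    \prod_(j < m) S (lift ord0 j) i i.
  by apply: (big_morph (fun A : 'M[C]_n => A i i)) => [A B|]; rewrite mxE.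
apply: ler_prod => j _; rewrite -!qform_delta (pS _).2 /=.
have := (pcS (lift ord0 j)).2 (delta_mx i 0).
by rewrite !qform_delta !mxE eqxx mulr1n subr_ge0.
Qed.

(** The extra factor [P] is an accumulator for the induction: expanding the head moves [A i] or
    [B i] into it, and Schur keeps it positive semidefinite. The triangle inequality and [|i| = 1]
    then give the step. *)
Lemma norm_qform_big_hadamard_le n (I : Type) (r : seq I)
    (A B : I -> 'M[C]_n) (P : 'M[C]_n) x :
    (forall i, psdmx (A i)) -> (forall i, psdmx (B i)) -> psdmx P ->
  `|qform (hadamard
      (\big[@hadamard C n n/const_mx 1]_(i <- r) (A i + 'i *: B i)) P) x| <=
  qform (hadamard (\big[@hadamard C n n/const_mx 1]_(i <- r) (A i + B i)) P) x.
Proof.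
move=> pA pB; elim: r P => [|i r IHr] P pP.
  rewrite !big_nil; have -> : hadamard (const_mx 1) P = P.
    by apply/matrixP => i j; rewrite !mxE mul1r.
  by rewrite ger0_norm // pP.2.
rewrite !big_cons; set Z := \big[_/_]_(_ <- r) (_ + 'i *: _).
set T := \big[_/_]_(_ <- r) _.
have -> : hadamard (hadamard (A i + 'i *: B i) Z) P =
    hadamard Z (hadamard (A i) P) + 'i *: hadamard Z (hadamard (B i) P).
  by apply/matrixP => k l; rewrite !mxE; ring.
have -> : hadamard (hadamard (A i + B i) T) P =
    hadamard T (hadamard (A i) P) + hadamard T (hadamard (B i) P).
  by apply/matrixP => k l; rewrite !mxE; ring.
rewrite !qformD qformZ (le_trans (ler_normD _ _)) // normrM normCi mul1r.
by rewrite lerD // IHr //; apply: hadamard_psd.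
Qed.

(** * Real and imaginary parts of an accretive-dissipative matrix *)

Lemma addr_le_norm_rect (a b : C) :
  0 <= a -> 0 <= b -> a + b <= sqrtC 2 * `|a + 'i * b|.
Proof.
move=> a0 b0; have aR := ger0_real a0; have bR := ger0_real b0.
rewrite -(@ler_pXn2r _ 2) ?nnegrE ?addr_ge0 ?mulr_ge0 ?sqrtC_ge0 //.
rewrite exprMn sqrtCK normC2_rect // -subr_ge0.
have -> : 2 * (a ^+ 2 + b ^+ 2) - (a + b) ^+ 2 = (a - b) ^+ 2 by ring.
by rewrite real_exprn_even_ge0 // rpredB.
Qed.

Lemma re_im_mxE n (X : 'M[C]_n) : X = re_mx X + 'i *: im_mx X.
Proof.
rewrite /im_mx scalerA invfM mulrCA divff ?neq0Ci // mulr1 -scalerDr.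
rewrite addrACA subrr addr0 -mulr2n -scaler_nat scalerA.
by rewrite mulVf ?scale1r ?pnatr_eq0.
Qed.

(** The form of [X] at [x] is [a + i b], where [a] and [b] are the nonnegative forms of its real and
    imaginary parts; hence [a + b] is at most [sqrt 2] times its modulus. *)
Lemma re_add_im_le n (X : 'M[C]_n) w :
    accretive_dissipative X -> 0 <= w ->
    (forall x, `|qform X x| <= w * cdot x x) ->
  psdmx ((sqrtC 2 * w)%:M - (re_mx X + im_mx X)).
Proof.
move=> [/posdef_psdmx pA /posdef_psdmx pB] w0 Xw.
have [/hermsymE hS _] := psdmxD pA pB.
have cR : (sqrtC 2 * w)^* = sqrtC 2 * w.
  by apply/CrealP; rewrite ger0_real ?mulr_ge0 ?sqrtC_ge0.
split=> [|x].
  apply/hermsymE => i j; move: (re_mx X + im_mx X) hS => S hS.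
  by rewrite !mxE rmorphB rmorphMn /= cR -hS eq_sym.
rewrite -[- _]scaleN1r qformD qformZ mulN1r qform_scalar subr_ge0 qformD.
apply: le_trans (addr_le_norm_rect (pA.2 x) (pB.2 x)) _.
rewrite -qformZ -qformD -re_im_mxE -mulrA ler_wpM2l ?sqrtC_ge0 //.
Qed.

(** * Unit vectors, homogeneity, and the bound for the whole product *)

Lemma cdot_enorm1 n (x : 'cV[C]_n) : enorm x = 1 -> cdot x x = 1.
Proof. by move=> x1; rewrite -[LHS]sqrtCK -/(enorm x) x1 expr1n. Qed.

Lemma norm_entry_le1 n (x : 'cV[C]_n) i : enorm x = 1 -> `|x i 0| <= 1.
Proof.
move=> /cdot_enorm1 x1; rewrite -(@ler_pXn2r _ 2) ?nnegrE // expr1n -x1.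
rewrite cdotxx (bigD1 i) //= lerDl sumr_ge0 // => j _.
by rewrite exprn_ge0.
Qed.

(** A crude bound, uniform in the unit vector [x]. It makes the set defining the numerical radius
    bounded above, so that its [sup] is an upper bound. *)
Lemma norm_qform_le n (A : 'M[C]_n) x : enorm x = 1 ->
  `|qform A x| <= \sum_i \sum_j `|A i j|.
Proof.
move=> x1; rewrite qformE.
apply: le_trans (ler_norm_sum _ _ _) _; apply: ler_sum => i _.
apply: le_trans (ler_norm_sum _ _ _) _; apply: ler_sum => j _.
rewrite !normrM norm_conjC -mulrA ler_piMr // mulr_ile1 //.
  exact: norm_entry_le1.
exact: norm_entry_le1.
Qed.

Lemma norm_qform_le_homogeneous n (A : 'M[C]_n) w :
    (forall u, enorm u = 1 -> `|qform A u| <= w) ->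
  forall x, `|qform A x| <= w * cdot x x.
Proof.
move=> Aw x; have [->|x0] := eqVneq x 0.
  by rewrite qform0 normr0 /cdot trmx0 linear0l mulr0.
have cx_gt0 : 0 < cdot x x by rewrite /cdot dnorm_gt0 trmx_eq0.
have e_gt0 : 0 < enorm x by rewrite sqrtC_gt0.
pose u := (enorm x)^-1 *: x.
(* Stated for every [B]: the case of the identity matrix shows below that [u] is a unit vector. *)
have qu (B : 'M[C]_n) : qform B x = cdot x x * qform B u.
  rewrite qform_scale ger0_norm ?invr_ge0 1?ltW // exprVn sqrtCK.
  by rewrite mulrA divff ?mul1r ?gt_eqF.
have u1 : enorm u = 1.
  have := qu 1%:M; rewrite !qform_scalar !mul1r => /esym.
  rewrite -[RHS]mulr1 => /(mulfI (lt0r_neq0 cx_gt0)).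
  by rewrite /enorm => ->; rewrite sqrtC1.
rewrite qu normrM (ger0_norm (ltW cx_gt0)) [leRHS]mulrC.
by rewrite ler_wpM2l ?Aw ?(ltW cx_gt0).
Qed.

Lemma norm_qform_accretive_dissipative_le n m (X : 'I_m -> 'M[C]_n)
    (w : 'I_m -> C) x :
    (0 < m)%N -> (forall j, accretive_dissipative (X j)) ->
    (forall j, 0 <= w j) ->
    (forall j x, `|qform (X j) x| <= w j * cdot x x) ->
  `|qform (\big[@hadamard C n n/const_mx 1]_(j < m) X j) x| <=
    (\prod_(j < m) (sqrtC 2 * w j)) * cdot x x.
Proof.
case: m X w => // m X w _ hX w0 Xw.
have psdA j : psdmx (re_mx (X j)) by apply: posdef_psdmx (hX j).1.
have psdB j : psdmx (im_mx (X j)) by apply: posdef_psdmx (hX j).2.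
have had1 (Z : 'M[C]_n) : hadamard Z (const_mx 1) = Z.
  by apply/matrixP => i j; rewrite !mxE mulr1.
under eq_bigr do rewrite (re_im_mxE (X _)).
(* The accumulator starts as the all-ones matrix, which [had1] then removes. *)
have := norm_qform_big_hadamard_le (index_enum 'I_m.+1) x psdA psdB
  (const1_psd n).
rewrite !had1 => /le_trans; apply.
apply: qform_big_hadamard_le => j; first exact: psdmxD.
  exact: re_add_im_le.
by rewrite mulr_ge0 ?sqrtC_ge0.
Qed.

End PositiveSemidefinite.

(** * The numerical radius as a real supremum *)

Section NumericalRadius.
Variable R : realType.
Local Open Scope complex_scope.
Implicit Type n : nat.

(** Bridge between the real-valued modulus of [numerical_radius] and the order of [R[i]] used in the
    estimates on forms. *)
Lemma normc_leP (z : R[i]) (a : R) : (Normc.normc z <= a) = (`|z| <= a%:C).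
Proof. by rewrite -lecR; case: z. Qed.

Lemma sqrtC2E : sqrtC 2 = (Num.sqrt 2)%:C :> R[i].
Proof.
have <- : (Num.sqrt 2)%:C ^+ 2 = 2 :> R[i].
  by rewrite -rmorphXn /= sqr_sqrtr // rmorph_nat.
by rewrite sqrCK // ler0c sqrtr_ge0.
Qed.

Lemma normc_le_numerical_radius n (A : 'M[R[i]]_n) x :
  enorm x = 1 -> Normc.normc (qform A x) <= numerical_radius A.
Proof.
move=> x1; apply: ub_le_sup; last by exists x.
exists (\sum_i \sum_j Normc.normc (A i j)) => _ [y y1 <-].
rewrite normc_leP; apply: le_trans (norm_qform_le A y1) _.
rewrite rmorph_sum; apply: ler_sum => i _.
rewrite rmorph_sum; apply: ler_sum => j _.
by rewrite -normc_leP.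
Qed.

Lemma numerical_radius_le n (A : 'M[R[i]]_n) a : 0 <= a ->
    (forall x, enorm x = 1 -> Normc.normc (qform A x) <= a) ->
  numerical_radius A <= a.
Proof.
move=> a0 Aa; rewrite /numerical_radius; set E := [set _ | _ in _]%classic.
(* Without unit vectors ([n = 0]) the supremum is [0] by convention, and the bound reduces to
   [0 <= a]. *)
have [->|E0] := eqVneq E set0; first by rewrite sup0.
by apply: ge_sup; [exact/set0P | move=> _ [x /Aa ? <-]].
Qed.

Lemma numerical_radius_ge0 n (A : 'M[R[i]]_n) : 0 <= numerical_radius A.
Proof.
rewrite /numerical_radius; set E := [set _ | _ in _]%classic.
have [->|/set0P[_ [x x1 _]]] := eqVneq E set0; first by rewrite sup0.
apply: le_trans (normc_le_numerical_radius A x1).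
by case: (qform A x) => a b; exact: sqrtr_ge0.
Qed.

Lemma qform_le_numerical_radius n (A : 'M[R[i]]_n) x :
  `|qform A x| <= (numerical_radius A)%:C * cdot x x.
Proof.
apply: norm_qform_le_homogeneous => u u1.
by rewrite -normc_leP normc_le_numerical_radius.
Qed.

End NumericalRadius.

Theorem corollary2p5 (R : realType) (n m : nat) (hm : (1 <= m)%N)
    (X : 'I_m -> 'M[R[i]]_n) (hX : forall j, accretive_dissipative (X j)) :
  numerical_radius (\big[@hadamard R[i] n n/const_mx 1]_(j < m) X j) <=
    2 `^ (m%:R / 2) * \prod_(j < m) numerical_radius (X j).
Proof.
(* Since [2^(m/2)] is [(sqrt 2)^m], each factor of the product receives one [sqrt 2]. *)
have -> : 2 `^ (m%:R / 2) * \prod_(j < m) numerical_radius (X j) =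
    \prod_(j < m) (Num.sqrt 2 * numerical_radius (X j)).
  rewrite big_split prodr_const card_ord [m%:R / 2]mulrC powRrM.
  by rewrite powR12_sqrt // powR_mulrn ?sqrtr_ge0.
have w_ge0 j : 0 <= Num.sqrt 2 * numerical_radius (X j).
  by rewrite mulr_ge0 ?sqrtr_ge0 ?numerical_radius_ge0.
apply: numerical_radius_le => [|x x1]; first by apply: prodr_ge0.
rewrite normc_leP rmorph_prod.
have := @norm_qform_accretive_dissipative_le R[i] n m X
  (fun j => (numerical_radius (X j))%:C%C) x hm hX.
rewrite (cdot_enorm1 x1) mulr1 => /(_ _ _)/le_trans; apply.
- by move=> j; rewrite ler0c numerical_radius_ge0.
- by move=> j y; exact: qform_le_numerical_radius.
rewrite [leRHS](eq_bigr (fun j => sqrtC 2 * (numerical_radius (X j))%:C%C)) //.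
by move=> j _; rewrite rmorphM; congr (_ * _); apply/esym/sqrtC2E.
Qed.
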